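(* Let $I\subset(0,\infty)$ be an interval, let $f:I\to\mathbb{R}$ be differentiable on $I^{\circ}$, and let $a,b\in I$ with $a<b$, where $f'$ exists at every point of $[a,b]$ (one-sided derivative at $a$ or $b$ if that point is an endpoint of $I$), and $f'\in L[a,b]$. Let $q>1$, $\frac1p+\frac1q=1$, and suppose $|f'|^q$ is harmonically convex on $[a,b]$. Then $$\left|\frac13\left[\frac{f(a)+f(b)}{2}+2f\left(\frac{2ab}{a+b}\right)\right]-\frac{ab}{b-a}\int_a^b\frac{f(x)}{x^2}\,dx\right|$$ $$\le\frac{ab(b-a)}{2}\left\{C_1\left(\tfrac13,p;a,b\right)^{\frac1p}\left(\frac{\left|f'\left(\frac{2ab}{a+b}\right)\right|^q+|f'(b)|^q}{4}\right)^{\frac1q}+C_1\left(\tfrac13,p;b,a\right)^{\frac1p}\left(\frac{\left|f'\left(\frac{2ab}{a+b}\right)\right|^q+|f'(a)|^q}{4}\right)^{\frac1q}\right\},$$ where, for $\lambda\in[0,1]$ and $u,\vartheta>0$, $C_1(\lambda,p;u,\vartheta)=\int_0^{1/2}\frac{|\lambda-2t|^p}{(t\vartheta+(1-t)u)^{2p}}\,dt$.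
   Context: A function $g:J\to\mathbb{R}$ on an interval $J\subset\mathbb{R}\setminus\{0\}$ is harmonically convex if $g\left(\frac{xy}{tx+(1-t)y}\right)\le t\,g(y)+(1-t)\,g(x)$ for all $x,y\in J$ and $t\in[0,1]$. $L[a,b]$ denotes the Lebesgue integrable functions on $[a,b]$. *)

(* Defs.v *)
From HB Require Import structures.
From mathcomp Require Import all_boot all_order all_algebra.
From mathcomp Require Import all_classical all_reals all_analysis.
Import Order.TTheory GRing.Theory Num.Theory.
Import numFieldNormedType.Exports.

Set Implicit Arguments.
Unset Strict Implicit.
Unset Printing Implicit Defensive.

Local Open Scope classical_set_scope.
Local Open Scope ring_scope.

(* A function I -> R is represented by a total function R -> R of which only
   the values on I matter. The difference quotient is therefore taken along
   points of I: this is the usual derivative at interior points of I, and the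
   one-sided derivative at an endpoint belonging to I. *)
Definition slope {R : realType} (f : R -> R) (x y : R) : R :=
  (f y - f x) / (y - x).

Definition derivable_in {R : realType} (I : set R) (f : R -> R) (x : R) : Prop :=
  cvg (slope f x y @[y --> within I x^']).

(* Junk value when ~ derivable_in I f x. *)
Definition derive_in {R : realType} (I : set R) (f : R -> R) (x : R) : R :=
  lim (slope f x y @[y --> within I x^']).

(* J is meant to be an interval not containing 0. *)
Definition harmonically_convex {R : realType} (J : set R) (g : R -> R) : Prop :=
  forall x y t : R, J x -> J y -> 0 <= t <= 1 ->
    g (x * y / (t * x + (1 - t) * y)) <= t * g y + (1 - t) * g x.

Definition C1 {R : realType} (lambda p u v : R) : R :=
  \int[lebesgue_measure]_(t in `[0, 2^-1])
    (`|lambda - 2 * t| `^ p / (t * v + (1 - t) * u) `^ (2 * p)).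

Lemma derive_in_interior {R : realType} (I : set R) (f : R -> R) (x : R) :
  I° x -> derivable f x 1 ->
  derivable_in I f x /\ derive_in I f x = f^`()%classic x.
Proof.
move=> Ix fx; rewrite /derivable_in /derive_in.
have -> : within I x^' = x^'.
  apply/seteqP; split => A; last by apply: filterS => y Ay _.
  rewrite /within /dnbhs /= => wA.
  have xI : nbhs x I by exact: Ix.
  by apply: filterS2 xI wA => y Iy wAy yx; apply: wAy.
suff H : slope f x y @[y --> x^'] --> f^`()%classic x.
  split; first by apply/cvg_ex; exists (f^`()%classic x).
  exact: (cvg_lim (@Rhausdorff R) H).
have {}fx : h^-1 *: (f (h + x) - f x) @[h --> 0^'] --> f^`()%classic x.
  move: fx; rewrite /derivable /derive1 => fx.
  by under eq_fun do rewrite -[X in f (X + _)]mulr1; exact: fx.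
move/cvgrPdist_lt : fx => fx; apply/cvgrPdist_lt => e /fx /nbhs_ballP[d d0 H].
apply/nbhs_ballP; exists d => // y /= xy yx.
have := H (y - x); rewrite /slope /= subrK -[_ *: _]mulrC; apply.
  by rewrite /ball/= sub0r opprB.
by rewrite subr_eq0.
Qed.

(* Main.v *)
(* With A t = t v + (1 - t) u and y t = u v / A t, the function
   F t = (2 t - 1/3) f (y t) + 2 u v / (v - u) P (y t), where P is a primitive
   of f x / x^2, satisfies |F' t| = |u v (v - u)| |1/3 - 2 t| / (A t)^2 |f' (y t)|.
   Harmonic convexity bounds |f' (y t)|^q on [0, 1/2] by its chord, which is
   affine in t, hence continuous; so the increment of F is at most the integral
   of a continuous function, to which Hoelder's inequality applies; f is never
   recovered from f' by integration. The claim is half the sum of the bounds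
   for (u, v) = (a, b) and (u, v) = (b, a). *)
Require Import Defs.
From HB Require Import structures.
From mathcomp Require Import all_boot all_order all_algebra.
From mathcomp Require Import all_classical all_reals all_analysis.
From mathcomp Require Import measurable_realfun ring lra.
Import Order.TTheory GRing.Theory Num.Theory.
Import numFieldNormedType.Exports.

Local Open Scope classical_set_scope.
Local Open Scope ring_scope.

Set Implicit Arguments.
Unset Strict Implicit.
Unset Printing Implicit Defensive.

(** * Continuous functions on a segment: powers, increments, Hoelder's inequality *)

(** At 0, [|y| < e^(1/p)] gives [|y|^p < e] directly; elsewhere [powR] is derivable at [|x| > 0]. *)
Lemma continuous_norm_powR (R : realType) (p : R) :
  0 < p -> continuous (fun x : R => `|x| `^ p).
Proof.
move=> p0 x; have [->|x0] := eqVneq x 0.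
  apply/cvgrPdist_lt => e e0; rewrite normr0 powR0 ?gt_eqF//.
  near=> y; rewrite sub0r normrN ger0_norm ?powR_ge0//.
  have -> : e = (e `^ p^-1) `^ p by rewrite -powRrM mulVf ?gt_eqF// powRr1 ?ltW.
  rewrite gt0_ltr_powR ?nnegrE ?powR_ge0//.
  have : `|0 - y| < e `^ p^-1.
    by near: y; apply: (@cvgr_dist_lt _ R^o) => //; rewrite powR_gt0.
  by rewrite sub0r normrN.
have : {for `|x|, continuous (fun y : R => y `^ p)}.
  apply: differentiable_continuous; apply/derivable1_diffP.
  by apply: derivable_powR; rewrite in_itv/= andbT normr_gt0.
move=> powR_at.
exact: (@continuous_comp R R R Num.norm (fun y : R => y `^ p) x
          (@norm_continuous _ R x) powR_at).
Unshelve. all: by end_near. Qed.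

Lemma continuous_integrable (R : realType) (a b : R) (w : R -> R) :
  {within `[a, b], continuous w} ->
  lebesgue_measure.-integrable `[a, b] (EFin \o w).
Proof. by apply: continuous_compact_integrable; exact: segment_compact. Qed.

(** Comparison of [F] with the primitive [W] of the continuous bound [w]; the derivative of [F]
    enters only through signs and is never integrated. *)
Lemma le_norm_increment_integral (R : realType) (a b : R) (F w : R -> R) :
  a < b -> {within `[a, b], continuous F} -> {within `[a, b], continuous w} ->
  (forall x, x \in `]a, b[ -> derivable F x 1) ->
  (forall x, x \in `]a, b[ -> `|F^`()%classic x| <= w x) ->
  `|F b - F a| <= \int[lebesgue_measure]_(x in `[a, b]) w x.
Proof.
move=> ab cF cw dF Fw.
have iw := continuous_integrable cw.
pose W x := parameterized_integral lebesgue_measure a x w.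
have cW : {within `[a, b], continuous W}.
  by apply: parameterized_integral_continuous iw; exact: ltW.
have dW x : x \in `]a, b[ -> derivable W x 1 /\ W^`()%classic x = w x.
  move=> /[dup] xab; rewrite in_itv/= => /andP[ax xb].
  apply: (continuous_FTC1_closed xb iw ax).
  exact: (within_continuous_continuous ab cw xab).
have Wa : W a = 0 by rewrite /W /parameterized_integral set_itv1 Rintegral_set1.
(* W + F and W - F are nondecreasing. *)
have mono (G : R -> R) : {within `[a, b], continuous G} ->
    (forall x, x \in `]a, b[ -> derivable G x 1) ->
    (forall x, x \in `]a, b[ -> 0 <= G^`()%classic x) -> G a <= G b.
  move=> cG dG G0; apply: (ger0_derive1_le_cc dG G0 cG);
    by rewrite ?in_itv/= ?lexx ltW.
rewrite ler_norml -[\int[_]_(x in _) _]/(W b); apply/andP; split.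
- suff : (W \+ F) a <= (W \+ F) b by rewrite /= Wa; lra.
  apply: mono => x.
  + by apply: continuousD; [exact: cW|exact: cF].
  + by move=> xab; apply: derivableD; [case: (dW _ xab)|exact: dF].
  + move=> xab; have [dWx Wx] := dW _ xab.
    rewrite derive1E deriveD//; last exact: dF.
    rewrite -!derive1E Wx -lerBlDr sub0r.
    by have := Fw _ xab; rewrite ler_norml lerNl => /andP[].
- suff : (W \- F) a <= (W \- F) b by rewrite /= Wa; lra.
  apply: mono => x.
  + by apply: continuousB; [exact: cW|exact: cF].
  + by move=> xab; apply: derivableB; [case: (dW _ xab)|exact: dF].
  + move=> xab; have [dWx Wx] := dW _ xab.
    rewrite derive1E deriveB//; last exact: dF.
    rewrite -!derive1E Wx subr_ge0.
    by have := Fw _ xab; rewrite ler_norml => /andP[].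
Qed.

Lemma within_continuous_norm_powR (R : realType) (A : set R) (p : R) (u : R -> R) :
  0 < p -> {within A, continuous u} ->
  {within A, continuous (fun x => `|u x| `^ p)}.
Proof.
move=> p0 cu x.
have h := @continuous_norm_powR R p p0 (u x).
exact: (@continuous_comp (subspace A) R R u (fun y : R => `|y| `^ p) x (cu x) h).
Qed.

Lemma Lnorm_itv (R : realType) (a b p : R) (u : R -> R) :
  0 < p -> {within `[a, b], continuous u} ->
  Lnorm lebesgue_measure p%:E (EFin \o (u \_ `[a, b])) =
  ((\int[lebesgue_measure]_(x in `[a, b]) (`|u x| `^ p)) `^ p^-1)%:E.
Proof.
move=> p0 cu; have iu := continuous_integrable (within_continuous_norm_powR p0 cu).
rewrite unlock -poweR_EFin.
rewrite /Rintegral fineK; last exact: integrable_fin_num.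
congr (_ `^ _)%E; rewrite [RHS]integral_mkcond; apply: eq_integral => x _ /=.
rewrite !patchE; case: ifPn => // _.
by rewrite normr0 powR0 ?gt_eqF.
Qed.

(** This is [hoelder] on the whole line for the extensions of [u] and [v] by zero. The left side
    arrives as an L^1 norm, whence the exponents [1] removed at the end. *)
Lemma hoelder_itv (R : realType) (a b p q : R) (u v : R -> R) :
  {within `[a, b], continuous u} -> {within `[a, b], continuous v} ->
  0 < p -> 0 < q -> p^-1 + q^-1 = 1 ->
  \int[lebesgue_measure]_(x in `[a, b]) `|u x * v x| <=
  (\int[lebesgue_measure]_(x in `[a, b]) (`|u x| `^ p)) `^ p^-1 *
  (\int[lebesgue_measure]_(x in `[a, b]) (`|v x| `^ q)) `^ q^-1.
Proof.
move=> cu cv p0 q0 pq.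
have mres w : {within `[a, b], continuous w} ->
    measurable_fun setT (w \_ `[a, b] : R -> R).
  move=> cw; have /integrableP[/measurable_EFinP mw _] := continuous_integrable cw.
  by have [+ _] := measurable_restrictT w (measurable_itv `[a, b]); apply; exact: mw.
have := hoelder lebesgue_measure (mres _ cu) (mres _ cv) p0 q0 pq.
rewrite !Lnorm_itv// -EFinM -lee_fin; apply: le_trans.
have cuv : {within `[a, b], continuous (fun x => u x * v x)}.
  by move=> x; apply: continuousM; [exact: cu|exact: cv].
rewrite (_ : EFin \o _ = EFin \o ((fun x => u x * v x) \_ `[a, b])); last first.
  apply/funext => x /=; rewrite !patchE; case: ifPn => // _.
  by rewrite mul0r.
rewrite (Lnorm_itv ltr01 cuv) lee_fin invr1.
have e : \int[lebesgue_measure]_(x in `[a, b]) (`|u x * v x| `^ 1) =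
         \int[lebesgue_measure]_(x in `[a, b]) `|u x * v x|.
  by apply: eq_Rintegral => x _; rewrite powRr1.
rewrite e powRr1//; exact: Rintegral_ge0.
Qed.

(** * The increment bound on [0, 1/2] in terms of [C1] *)

(** The chord has mean [(x + y) / 2] over an interval of length 1/2: this is the source of the
    denominators 4 in the final bound. *)
Lemma Rintegral_affine (R : realType) (x y : R) :
  \int[lebesgue_measure]_(t in `[0, 2^-1]) ((1 - 2 * t) * x + 2 * t * y) =
  (x + y) / 4.
Proof.
pose F t := t * x + t ^+ 2 * (y - x).
have dF (t : R) : is_derive t 1 F ((1 - 2 * t) * x + 2 * t * y).
  apply: is_derive_eq.
  by rewrite /GRing.scale/=; ring.
have cF : continuous F.
  by move=> t; apply/differentiable_continuous/derivable1_diffP; case: (dF t).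
have half0 : (0 : R) < 2^-1 by rewrite invr_gt0.
rewrite /Rintegral (@continuous_FTC2 _ _ F _ _ half0)/=.
- by rewrite /F; field.
- apply: continuous_subspaceT => t.
  apply: cvgD.
    apply: cvgMr_tmp; apply: cvgB; first exact: cvg_cst.
    by apply: cvgMl_tmp; exact: cvg_id.
  by apply: cvgMr_tmp; apply: cvgMl_tmp; exact: cvg_id.
- split=> [t _||]; first by case: (dF t).
  + exact/cvg_at_right_filter/cF.
  + exact/cvg_at_left_filter/cF.
- by move=> t _; rewrite derive1E; apply: derive_val.
Qed.

Lemma powR_sqrV (R : realType) (x p : R) : 0 < x -> (x ^+ 2)^-1 `^ p = (x `^ (2 * p))^-1.
Proof.
move=> x0; rewrite -powRN -powR_inv1 ?exprn_ge0 ?ltW// -powR_mulrn ?ltW//.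
rewrite -!powRrM.
by rewrite mulNr mul1r mulrN.
Qed.

Lemma affine_combination_gt0 (R : realFieldType) (u v t : R) :
  0 < u -> 0 < v -> 0 <= t <= 1 -> 0 < t * v + (1 - t) * u.
Proof.
move=> u0 v0 /andP[]; rewrite le_eqVlt => /predU1P[<- _|t0 t1].
  by rewrite mul0r add0r subr0 mul1r.
by rewrite ltr_pwDl// ?mulr_gt0// mulr_ge0 ?subr_ge0// ltW.
Qed.

(** The pointwise bound first replaces [|g t|] by the [q]-th root [be] of the chord [l], which is
    continuous. Hoelder's inequality then separates the kernel [al], whose [p]-th power integrates
    to [C1], from [be], whose [q]-th power integrates to [(x + y) / 4]. *)
Lemma C1_itv_bound (R : realType) (lam u v p q c x y : R) (F g : R -> R) :
  0 < u -> 0 < v -> 0 < p -> 0 < q -> p^-1 + q^-1 = 1 ->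
  0 <= c -> 0 <= x -> 0 <= y ->
  {within `[0, 2^-1], continuous F} ->
  (forall t, t \in `]0, 2^-1[ -> derivable F t 1) ->
  (forall t, t \in `]0, 2^-1[ ->
    `|F^`()%classic t| <=
    c * (`|lam - 2 * t| / (t * v + (1 - t) * u) ^+ 2 * `|g t|)) ->
  (forall t, t \in `]0, 2^-1[ -> `|g t| `^ q <= (1 - 2 * t) * x + 2 * t * y) ->
  `|F 2^-1 - F 0| <= c * (C1 lam p u v `^ p^-1 * ((x + y) / 4) `^ q^-1).
Proof.
move=> u0 v0 p0 q0 pq c0 x0 y0 cF dF Fg gq.
have half0 : (0 : R) < 2^-1 by rewrite invr_gt0.
pose A t := t * v + (1 - t) * u.
have A0 t : t \in `[0, 2^-1] -> 0 < A t.
  rewrite in_itv/= => /andP[t0 t1]; apply: affine_combination_gt0 => //.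
  by rewrite t0/= (le_trans t1)// invf_le1// ler1n.
pose l t := (1 - 2 * t) * x + 2 * t * y.
have l0 t : t \in `[0, 2^-1] -> 0 <= l t.
  rewrite in_itv/= => /andP[t0 t1].
  by rewrite /l addr_ge0// mulr_ge0//; lra.
pose al t := (lam - 2 * t) / A t ^+ 2.
(* The absolute value changes nothing on [0, 1/2], where [l] is nonnegative; it gives the form whose
   continuity is known. *)
pose be t := `|l t| `^ q^-1.
have cl : continuous l.
  move=> t; apply: cvgD.
    apply: cvgMr_tmp; apply: cvgB; first exact: cvg_cst.
    by apply: cvgMl_tmp; exact: cvg_id.
  by apply: cvgMr_tmp; apply: cvgMl_tmp; exact: cvg_id.
have cal : {within `[0, 2^-1], continuous al}.
  apply: continuous_in_subspaceT => t; rewrite inE/= => /A0 At0.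
  apply: cvgM.
    by apply: cvgB; [exact: cvg_cst|apply: cvgMl_tmp; exact: cvg_id].
  apply: cvgV; first by rewrite expf_neq0// gt_eqF.
  suff cA : A z @[z --> t] --> A t by apply: cvgM.
  apply: cvgD; first by apply: cvgMr_tmp; exact: cvg_id.
  by apply: cvgMr_tmp; apply: cvgB; [exact: cvg_cst|exact: cvg_id].
have cbe : {within `[0, 2^-1], continuous be}.
  apply: within_continuous_norm_powR; first by rewrite invr_gt0.
  exact: continuous_subspaceT.
have cab : {within `[0, 2^-1], continuous (fun t => `|al t * be t|)}.
  move=> t; apply: cvg_norm.
  by apply: continuousM; [exact: cal|exact: cbe].
have albe : `|F 2^-1 - F 0| <=
    \int[lebesgue_measure]_(t in `[0, 2^-1]) (c * `|al t * be t|).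
  apply: le_norm_increment_integral => //.
    move=> t; apply: cvgMl_tmp; exact: cab.
  move=> t t01; have t01' := subset_itv_oo_cc t01.
  apply: (le_trans (Fg _ t01)); apply: ler_wpM2l => //.
  rewrite normrM; apply: ler_pM => //.
  - by rewrite divr_ge0// exprn_ge0// ltW// A0.
  - by rewrite normrM normfV (ger0_norm (exprn_ge0 _ (ltW (A0 _ t01')))).
  - rewrite (ger0_norm (powR_ge0 _ _)) (ger0_norm (l0 _ t01')).
    have -> : `|g t| = (`|g t| `^ q) `^ q^-1.
      by rewrite -powRrM mulfV ?gt_eqF// powRr1.
    by rewrite ge0_ler_powR ?invr_ge0 ?nnegrE ?powR_ge0 ?l0 ?gq// ltW.
apply: (le_trans albe); rewrite RintegralZl//; last exact: continuous_integrable.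
have eC : \int[lebesgue_measure]_(t in `[0, 2^-1]) (`|al t| `^ p) = C1 lam p u v.
  rewrite /C1; apply: eq_Rintegral => t; rewrite inE/= => /A0 At0.
  rewrite normrM normfV (ger0_norm (exprn_ge0 _ (ltW At0))) powRM//; last first.
    by rewrite invr_ge0 exprn_ge0// ltW.
  by rewrite powR_sqrV.
have el : \int[lebesgue_measure]_(t in `[0, 2^-1]) (`|be t| `^ q) = (x + y) / 4.
  rewrite -Rintegral_affine; apply: eq_Rintegral => t; rewrite inE/= => t01.
  rewrite (ger0_norm (powR_ge0 _ _)) -powRrM mulVf ?gt_eqF// powRr1//.
  by rewrite ger0_norm// l0.
by apply: ler_wpM2l => //; rewrite -eC -el; exact: hoelder_itv.
Qed.

(** * Weighted harmonic means and the bound for one half *)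

(** Once the denominator is cleared, each gap is a combination of two nonnegative distances with
    positive weights. They cannot both vanish, because [u != v]. *)
Lemma harmonic_mean_itv (R : realFieldType) (a b u v t : R) :
  0 < a -> u \in `[a, b] -> v \in `[a, b] -> u != v -> 0 < t < 1 ->
  u * v / (t * v + (1 - t) * u) \in `]a, b[.
Proof.
rewrite !in_itv/= => a0 /andP[au ub] /andP[av vb] uv /andP[t0 t1].
have u0 : 0 < u by exact: lt_le_trans au.
have v0 : 0 < v by exact: lt_le_trans av.
have A0 : 0 < t * v + (1 - t) * u.
  by apply: affine_combination_gt0 => //; rewrite !ltW.
have tv : 0 < t * v by rewrite mulr_gt0.
have tu : 0 < (1 - t) * u by rewrite mulr_gt0// subr_gt0.
have pos x y : 0 <= x -> 0 <= y -> 0 < x + y -> 0 < t * v * x + (1 - t) * u * y.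
  move=> x0 y0 xy; have [{}x0|x_le0] := ltP 0 x.
    by rewrite ltr_pwDl// ?mulr_gt0// mulr_ge0// ltW.
  by rewrite ltr_wpDl ?mulr_gt0// ?mulr_ge0 ?(ltW tv)//; lra.
rewrite ltr_pdivlMr// ltr_pdivrMr//; apply/andP; split; rewrite -subr_gt0.
- rewrite (_ : _ - _ = t * v * (u - a) + (1 - t) * u * (v - a)); last by ring.
  by move: uv; rewrite neq_lt => /orP[] uv; apply: pos; lra.
- rewrite (_ : _ - _ = t * v * (b - u) + (1 - t) * u * (b - v)); last by ring.
  by move: uv; rewrite neq_lt => /orP[] uv; apply: pos; lra.
Qed.

(** The left side is the increment of [F] over [0, 1/2], along which [y] runs from [v] to the
    harmonic mean [h]. The order of [u] and [v] is left open so that both ends of [[a, b]] can take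
    the place of [v]. *)
Lemma harmonic_half_bound (R : realType) (a b u v p q h : R) (f df P : R -> R) :
  0 < a -> u \in `[a, b] -> v \in `[a, b] -> u != v ->
  0 < p -> 0 < q -> p^-1 + q^-1 = 1 ->
  continuous f ->
  (forall x, x \in `]a, b[ -> is_derive x 1 f (df x)) ->
  (forall x, x \in `[a, b] -> is_derive x 1 P (f x / x ^+ 2)) ->
  harmonically_convex `[a, b] (fun x => `|df x| `^ q) ->
  h = 2 * u * v / (u + v) ->
  `|3^-1 * f v + 2 / 3 * f h - 2 * (u * v / (v - u)) * (P v - P h)| <=
  `|u * v * (v - u)| *
  (C1 3^-1 p u v `^ p^-1 * ((`|df h| `^ q + `|df v| `^ q) / 4) `^ q^-1).
Proof.
move=> a0 uab vab uv p0 q0 pq cf Df DP hc hE.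
have u0 : 0 < u by move: uab; rewrite in_itv/= => /andP[au _]; exact: lt_le_trans au.
have v0 : 0 < v by move: vab; rewrite in_itv/= => /andP[av _]; exact: lt_le_trans av.
have uvD0 : u + v != 0 by rewrite gt_eqF// addr_gt0.
have uvB0 : v - u != 0 by rewrite subr_eq0 eq_sym.
pose A t := t * v + (1 - t) * u.
pose y t := u * v / A t.
(* The value 0 is excluded: [y 0 = v] may be an endpoint, where [Df] says nothing. *)
have half_in t : t \in `]0, 2^-1] -> y t \in `]a, b[.
  rewrite in_itv/= => /andP[t0 t1]; apply: harmonic_mean_itv => //.
  by rewrite t0/= (le_lt_trans t1)// invf_lt1// ltr1n.
have y0 : y 0 = v by rewrite /y /A mul0r add0r subr0 mul1r mulrAC divff ?mul1r ?gt_eqF.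
have yh : y 2^-1 = h.
  by rewrite /y /A hE; field.
have in_half t : t \in `[0, 2^-1] -> y t \in `[a, b].
  rewrite in_itv/= le_eqVlt => /andP[/predU1P[<- _|t0 t1]]; first by rewrite y0.
  by apply: subset_itv_oo_cc; apply: half_in; rewrite in_itv/= t0.
have A0 t : t \in `[0, 2^-1] -> 0 < A t.
  rewrite in_itv/= => /andP[t0 t1]; apply: affine_combination_gt0 => //.
  by rewrite t0/= (le_trans t1)// invf_le1// ler1n.
have Dy (t : R) : t \in `[0, 2^-1] -> is_derive t 1 y (- (u * v * (v - u) / A t ^+ 2)).
  move=> /A0 At0; have At : A t != 0 by rewrite gt_eqF.
  have DA : is_derive t 1 A (v - u).
    by apply: is_derive_eq; rewrite /GRing.scale/=; ring.
  have DV := is_deriveV At DA.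
  rewrite (_ : y = cst (u * v) * (fun z => (A z)^-1)); last exact/funext.
  apply: is_derive_eq.
  by rewrite /GRing.scale/=; field.
(* With this constant [K * y' / y ^+ 2 = -1], so the derivative of [2 * K * P (y t)] cancels the
   term [2 * f (y t)] that comes from the weight [2 * t - 3^-1]. *)
pose K := u * v / (v - u).
pose F t := (2 * t - 3^-1) * f (y t) + 2 * K * P (y t).
have DF (t : R) : t \in `]0, 2^-1[ ->
    is_derive t 1 F (- ((2 * t - 3^-1) * df (y t) * (u * v * (v - u) / A t ^+ 2))).
  move=> t01.
  have t01' : t \in `[0, 2^-1] by exact: subset_itv_oo_cc.
  have At : A t != 0 by rewrite gt_eqF// A0.
  have Dyt := Dy _ t01'.
  have Dfy : is_derive t 1 (f \o y) (df (y t) * - (u * v * (v - u) / A t ^+ 2)).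
    apply: is_derive1_comp; apply: Df; apply: half_in.
    by move: t01; rewrite !in_itv/= => /andP[-> /ltW].
  have DPy : is_derive t 1 (P \o y) (f (y t) / y t ^+ 2 * - (u * v * (v - u) / A t ^+ 2)).
    by apply: is_derive1_comp; apply: DP; exact: in_half.
  rewrite (_ : F = (fun t => 2 * t - 3^-1) * (f \o y) + cst (2 * K) * (P \o y)); last first.
    exact/funext.
  apply: is_derive_eq.
  rewrite /GRing.scale/=; set fy := f _; set dfy := df _; set Py := P _.
  by rewrite /K /y; field; rewrite uvB0 At !gt_eqF.
have := @C1_itv_bound R 3^-1 u v p q `|u * v * (v - u)| (`|df v| `^ q) (`|df h| `^ q)
  F (df \o y) u0 v0 p0 q0 pq (normr_ge0 _) (powR_ge0 _ _) (powR_ge0 _ _).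
rewrite [_ `^ q + _]addrC => bound.
rewrite (_ : _ - _ = F 2^-1 - F 0); last first.
  by rewrite /F y0 yh -/K; field.
apply: bound.
- apply: continuous_in_subspaceT => t; rewrite inE/= => t01.
  have cy : {for t, continuous y}.
    by apply/differentiable_continuous/derivable1_diffP; case: (Dy _ t01).
  have cPy : {for y t, continuous P}.
    apply/differentiable_continuous/derivable1_diffP.
    by case: (DP _ (in_half _ t01)).
  apply: cvgD.
    apply: cvgM; last exact: (@continuous_comp R R R y f t cy (cf _)).
    by apply: cvgB; [apply: cvgMl_tmp; exact: cvg_id|exact: cvg_cst].
  by apply: cvgMl_tmp; exact: (@continuous_comp R R R y P t cy cPy).
- by move=> t /DF[].
- move=> t t01; have DFt := DF _ t01.
  rewrite derive1E derive_val normrN !normrM normfV.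
  rewrite (ger0_norm (exprn_ge0 _ (ltW (A0 _ (subset_itv_oo_cc t01))))).
  by rewrite (distrC _ 3^-1) le_eqVlt; apply/orP; left; apply/eqP; ring.
- move=> t t01 /=.
  have hab : h \in `[a, b] by rewrite -yh; apply: in_half; rewrite in_itv/= lexx invr_ge0 ler0n.
  have t01' : t \in `[0, 2^-1] by exact: subset_itv_oo_cc.
  have t2 : 0 <= 2 * t <= 1 by move: t01'; rewrite in_itv/= => /andP[? ?]; lra.
  (* Since [(y t)^-1] is affine in [t], the point [y t] is the harmonic interpolation between [v]
     (at 0) and [h] (at 1/2) with parameter [2 * t]. *)
  have := hc v h (2 * t) vab hab t2.
  rewrite [in leRHS]addrC /= (_ : 2 * t * v + (1 - 2 * t) * h = 2 * v * A t / (u + v)); last first.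
    by rewrite hE /A; field.
  rewrite (_ : v * h / _ = y t)//.
  have At : A t != 0 by rewrite gt_eqF// A0.
  by rewrite hE /y; field; rewrite At uvD0 gt_eqF.
Qed.

(** * Passage from [f] on [I] to functions on the whole line *)

(** Write [f y = f x + slope f x y * (y - x)] for [y != x] and let the slope converge; the point
    [y = x], absent from the punctured filter, is treated apart. *)
Lemma derivable_in_continuous (R : realType) (I : set R) (f : R -> R) (x : R) :
  derivable_in I f x -> f y @[y --> within I (nbhs x)] --> f x.
Proof.
rewrite /derivable_in => /cvg_ex[/= l fl].
have id_x : (y - x) @[y --> within I x^'] --> x - x.
  apply: cvgB; last exact: cvg_cst.
  apply: cvg_within_filter; apply: cvg_within_filter; exact: cvg_id.
have : f x + slope f x y * (y - x) @[y --> within I x^'] --> f x + l * (x - x).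
  by apply: cvgD; [exact: cvg_cst|exact: cvgM].
rewrite subrr mulr0 addr0 => /cvgrPdist_lt H; apply/cvgrPdist_lt => e e0.
have : \forall y \near x, y != x -> I y ->
  `|f x - (f x + slope f x y * (y - x))| < e := H e e0.
apply: filterS => y Hy Iy; have [->|yx] := eqVneq y x; first by rewrite subrr normr0.
by have := Hy yx Iy; rewrite /slope divfK ?subr_eq0// addrCA subrr addr0.
Qed.

Lemma continuous_clamp (R : realType) (a b : R) :
  continuous (fun x : R => Num.max a (Num.min b x)).
Proof.
move=> x; apply: (@continuous_max _ R (fun=> a) (fun x => Num.min b x) x).
  exact: cst_continuous.
apply: (@continuous_min _ R (fun=> b) id x); first exact: cst_continuous.
by move=> y; exact: cvg_id.
Qed.

Lemma exists_primitive (R : realType) (a b : R) (g : R -> R) :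
  continuous g ->
  exists P : R -> R, forall x, x \in `[a, b] -> is_derive x 1 P (g x).
Proof.
(* Integrating from [a - 1], inside [[a - 1, b + 1]], makes [a] and [b] interior points, so the
   derivative there is two-sided. *)
move=> cg; exists (fun x => \int[lebesgue_measure]_(t in `[a - 1, x]) g t) => x.
rewrite in_itv/= => /andP[ax xb].
have ig : lebesgue_measure.-integrable `[a - 1, b + 1] (EFin \o g).
  by apply: continuous_integrable; exact: continuous_subspaceT.
have [||dP Px] := @continuous_FTC1_closed R g (a - 1) x (b + 1) _ ig _ (cg x).
- by rewrite ltr_pwDr.
- by rewrite ltrBlDr ltr_pwDr.
- by split; rewrite -?derive1E.
Qed.

Unset Implicit Arguments.
Set Strict Implicit.

Theorem corollary6 (R : realType) (I : set R) (f : R -> R) (a b p q : R)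
    (Iitv : is_interval I) (Ipos : I `<=` [set x | 0 < x])
    (df_int : forall x, I° x -> derivable f x 1)
    (Ia : I a) (Ib : I b) (ab : a < b)
    (df_ab : forall x, x \in `[a, b] -> derivable_in I f x)
    (df_L1 : lebesgue_measure.-integrable `[a, b] (EFin \o derive_in I f))
    (q1 : 1 < q) (pq : p^-1 + q^-1 = 1)
    (hc : harmonically_convex `[a, b] (fun x => `|derive_in I f x| `^ q)) :
  let f' := derive_in I f in
  let h := 2 * a * b / (a + b) in
  `| 3^-1 * ((f a + f b) / 2 + 2 * f h)
     - a * b / (b - a)
       * \int[lebesgue_measure]_(x in `[a, b]) (f x / x ^+ 2) |
  <= a * b * (b - a) / 2 *
     (C1 3^-1 p a b `^ p^-1
        * ((`|f' h| `^ q + `|f' b| `^ q) / 4) `^ q^-1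
      + C1 3^-1 p b a `^ p^-1
        * ((`|f' h| `^ q + `|f' a| `^ q) / 4) `^ q^-1).
Proof.
cbv zeta; set f' := derive_in I f; set h := 2 * a * b / (a + b).
have a0 : 0 < a := Ipos _ Ia.
have b0 : 0 < b := Ipos _ Ib.
have q0 : 0 < q by exact: lt_trans q1.
(* Here [p^-1 = 1 - q^-1] is positive; as [0^-1 = 0], this also excludes [p = 0]. *)
have p0 : 0 < p.
  by rewrite -invr_gt0 -(addrK q^-1 p^-1) pq subr_gt0 invf_lt1.
have abI x : x \in `[a, b] -> I x by rewrite in_itv/=; exact: Iitv.
pose c x := Num.max a (Num.min b x).
have cc : continuous c by exact: continuous_clamp.
have c_itv x : c x \in `[a, b].
  by rewrite in_itv/= le_max lexx/= ge_max ge_min lexx ltW.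
have c_id x : x \in `[a, b] -> c x = x.
  by rewrite in_itv/= => /andP[ax xb]; rewrite /c (min_idPr xb) (max_idPr ax).
have a_in : a \in `[a, b] by rewrite in_itv/= lexx ltW.
have b_in : b \in `[a, b] by rewrite in_itv/= lexx ltW.
have h_in : h \in `[a, b].
  apply: subset_itv_oo_cc.
  rewrite /h (_ : _ / _ = a * b / (2^-1 * b + (1 - 2^-1) * a)); last first.
    by field; rewrite !gt_eqF ?addr_gt0.
  by rewrite harmonic_mean_itv ?lt_eqF// invr_gt0 ltr0n/= invf_lt1// ltr1n.
(* f is only controlled on I, whereas f \o c is continuous on the whole line. *)
pose g := f \o c.
have gE x : x \in `[a, b] -> g x = f x by move=> /c_id; rewrite /g/= => ->.
have cg : continuous g.
  (* All values of [c] lie in [I], so continuity of [f] along [I], even one-sided, is enough for the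
     composite. *)
  move=> x; have cx : c y @[y --> x] --> within I (nbhs (c x)).
    move=> A wA; have : nbhs x (c @^-1` (fun y => I y -> A y)) := cc x _ wA.
    by apply: filterS => y; apply; exact: (abI _ (c_itv y)).
  have fc := derivable_in_continuous (df_ab _ (c_itv x)).
  have /= := cvg_comp c f cx fc; apply.
have Dg x : x \in `]a, b[ -> is_derive x 1 g (f' x).
  move=> xab.
  (* Inside []a, b[] the derivative along [I] is the usual one, and [g] coincides with [f]
     nearby. *)
  have Ix : I° x.
    rewrite /interior; near=> y; apply: abI; apply: subset_itv_oo_cc.
    by near: y; exact: near_in_itvoo.
  have [_ f'x] := derive_in_interior Ix (df_int _ Ix).
  apply: (@near_eq_is_derive _ _ _ f) => //.
    near=> y; apply/esym/gE; apply: subset_itv_oo_cc.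
    by near: y; exact: near_in_itvoo.
  by split; [exact: df_int|rewrite /f' f'x derive1E].
(* The denominator is at least [a ^+ 2 > 0], so [k] is continuous on the whole line, even at 0. *)
pose k x := g x / c x ^+ 2.
have ck : continuous k.
  move=> x; apply: cvgM; first exact: cg.
  apply: cvgV; last by apply: cvgM; exact: cc.
  by rewrite expf_neq0// gt_eqF// (lt_le_trans a0)// (itvP (c_itv x)).
have [P DP] := exists_primitive a b ck.
have DP' x : x \in `[a, b] -> is_derive x 1 P (g x / x ^+ 2).
  by move=> xab; have := DP _ xab; rewrite /k c_id.
have PE : \int[lebesgue_measure]_(x in `[a, b]) (f x / x ^+ 2) = P b - P a.
  have cP x : x \in `[a, b] -> {for x, continuous P}.
    by move=> /DP[dP _]; apply/differentiable_continuous/derivable1_diffP.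
  transitivity (\int[lebesgue_measure]_(x in `[a, b]) k x).
    apply: eq_Rintegral => x; rewrite inE/= => xab.
    by rewrite /k gE// c_id.
  rewrite /Rintegral (@continuous_FTC2 _ k P)//.
  - exact: continuous_subspaceT.
  - split=> [x xab||].
    + by case: (DP _ (subset_itv_oo_cc xab)).
    + exact/cvg_at_right_filter/cP.
    + exact/cvg_at_left_filter/cP.
  - move=> x xab; rewrite derive1E.
    by case: (DP _ (subset_itv_oo_cc xab)).
have Hab := harmonic_half_bound a0 a_in b_in (negbT (lt_eqF ab)) p0 q0 pq cg Dg DP' hc
  (erefl h).
have hE : h = 2 * b * a / (b + a) by rewrite /h (mulrAC 2) (addrC a).
have Hba := harmonic_half_bound a0 b_in a_in (negbT (gt_eqF ab)) p0 q0 pq cg Dg DP' hc hE.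
rewrite !gE// in Hab Hba; rewrite PE.
(* Exchanging [a] and [b] changes the sign of [a * b / (b - a)], so the terms in [P h] cancel and
   [P b - P a] remains. *)
rewrite (_ : _ - _ = 2^-1 *
    ((3^-1 * f b + 2 / 3 * f h - 2 * (a * b / (b - a)) * (P b - P h)) +
     (3^-1 * f a + 2 / 3 * f h - 2 * (b * a / (a - b)) * (P a - P h)))); last first.
  by field; rewrite !subr_eq0 ?(gt_eqF ab) ?(lt_eqF ab).
rewrite normrM ger0_norm ?invr_ge0// [leRHS]mulrAC (mulrC 2^-1) ler_pM2r ?invr_gt0//.
apply: (le_trans (ler_normD _ _)); rewrite [leRHS]mulrDr.
have nab : `|a * b * (b - a)| = a * b * (b - a).
  by rewrite ger0_norm// !mulr_ge0 ?subr_ge0 ?ltW.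
have nba : `|b * a * (a - b)| = a * b * (b - a).
  by rewrite -nab normrM distrC -normrM (mulrC b a).
by rewrite nab in Hab; rewrite nba in Hba; exact: lerD Hab Hba.
Unshelve. all: by end_near. Qed.
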